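(* Let $A\in\mathbb{R}^{d\times d}$ with $\rho(A)<1$, let $C=(I-A)^{-1}$, and let $P\in\mathbb{R}^{d\times d}$ be a (row-)stochastic matrix with $P_{i,j}>0$ if and only if $A_{i,j}\ne0$, such that the Markov chain on $[d]=\{1,\dots,d\}$ with transition matrix $P$ is irreducible and aperiodic and such that $\rho(\widehat H)<1$, where $\widehat H_{i,j}=A_{i,j}^2/P_{i,j}$ if $P_{i,j}\ne0$ and $\widehat H_{i,j}=0$ otherwise. With $Z_{ij}$ and $\alpha^{ij}$ as defined in the context, the following hold. (1) For every $i\in[d]$, $$\mathbb{E}[Z_{ii}]=\frac1{1-\mathbb{E}[\alpha^{ii}]}=C_{i,i}.$$ (2) For all $i\ne j$ in $[d]$, $Z_{ij}$ has the same distribution as the product of two independent random variables, one distributed as $\alpha^{ij}$ and the other as $Z_{jj}$; consequently $$C_{i,j}=\mathbb{E}[\alpha^{ij}]\,C_{j,j}.$$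
   Context: $\rho(\cdot)$ denotes the spectral radius. For $i\in[d]$ let $X(0)=i,X(1),X(2),\dots$ be the Markov chain with transition matrix $P$ started at $i$, and define weights $W_0=1$, $W_k=W_{k-1}\,A_{X(k-1),X(k)}/P_{X(k-1),X(k)}$ for $k\ge1$. For $j\in[d]$ (including $j=i$), with the chain started at $X(0)=i$, let $$\tau^{ij}=\inf\{t>0: X(t)=j\},\qquad \alpha^{ij}=\prod_{\ell=1}^{\tau^{ij}}\frac{A_{X(\ell-1),X(\ell)}}{P_{X(\ell-1),X(\ell)}},\qquad Z_{ij}=\sum_{k=0}^\infty W_k\,\mathbb{1}_{[X(k)=j]}.$$ Thus $\alpha^{ii}$ is the weight accumulated over one return cycle to $i$, and $\alpha^{ij}$ ($i\neq j$) is the weight accumulated until the first visit to $j$. *)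

(* Defs.v *)
From HB Require Import structures.
From mathcomp Require Import all_boot all_order all_algebra.
From mathcomp Require Import all_classical all_reals all_analysis.
From mathcomp Require Import complex.

Set Implicit Arguments.
Unset Strict Implicit.
Unset Printing Implicit Defensive.

Import Order.TTheory GRing.Theory Num.Theory.
Import numFieldNormedType.Exports.

Local Open Scope classical_set_scope.
Local Open Scope ring_scope.

(* The eigenvalues of the real matrix A are taken in R[i]; [complex.Re `|l|]
   is the modulus of l, read as an element of R. *)
Definition spectral_radius (R : realType) (d : nat) (A : 'M[R]_d) : R :=
  sup [set complex.Re `|l| |
       l in [set l : R[i] | eigenvalue (map_mx (real_complex R) A) l]].

Definition stochastic (R : realType) (d : nat) (P : 'M[R]_d) : Prop :=
  (forall i j, 0 <= P i j) /\ (forall i, \sum_j P i j = 1).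

Definition irreducible_chain (R : realType) (d : nat) (P : 'M[R]_d) : Prop :=
  forall i j, exists n : nat, 0 < (P ^+ n) i j.

(* p is the gcd of the return times {n > 0 | (P ^ n) i i > 0}, characterised by
   its universal property since this set is infinite. *)
Definition is_period (R : realType) (d : nat) (P : 'M[R]_d) (i : 'I_d)
    (p : nat) : Prop :=
  let common_divisor g :=
    forall n : nat, (0 < n)%N -> 0 < (P ^+ n) i i -> (g %| n)%N in
  common_divisor p /\ forall g, common_divisor g -> (g %| p)%N.

Definition aperiodic_chain (R : realType) (d : nat) (P : 'M[R]_d) : Prop :=
  forall i, is_period P i 1.

Definition Hhat (R : realType) (d : nat) (A P : 'M[R]_d) : 'M[R]_d :=
  \matrix_(i, j) (if P i j != 0 then A i j ^+ 2 / P i j else 0).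

(* The third clause is the Markov property
     Pr (X_(n+1) = s_(n+1) | X_0 = s_0, ..., X_n = s_n) = P s_n s_(n+1)
   multiplied out, so that conditioning events of probability 0 need no special
   treatment. *)
Definition markov_chain (R : realType) (d : nat) (disp : measure_display)
    (T : measurableType disp) (Pr : probability T R) (P : 'M[R]_d) (i : 'I_d)
    (X : nat -> T -> 'I_d) : Prop :=
  [/\ forall k j, measurable [set w | X k w = j],
      Pr [set w | X 0%N w = i] = 1%E &
      forall (n : nat) (s : nat -> 'I_d),
        (Pr [set w | forall k, (k <= n.+1)%N -> X k w = s k] =
         Pr [set w | forall k, (k <= n)%N -> X k w = s k] *
         (P (s n) (s n.+1))%:E)%E].

Fixpoint weight (R : realType) (d : nat) (A P : 'M[R]_d) (T : Type)
    (X : nat -> T -> 'I_d) (k : nat) (w : T) : R :=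
  if k is k'.+1 then
    weight A P X k' w * (A (X k' w) (X k w) / P (X k' w) (X k w))
  else 1.

(* None stands for an infinite time. *)
Definition hitting_time (d : nat) (T : Type) (X : nat -> T -> 'I_d)
    (j : 'I_d) (w : T) : option nat :=
  match pselect (exists t, (0 < t)%N && (X t w == j)) with
  | left h => Some (ex_minn h)
  | right _ => None
  end.

(* The value 0 at an infinite hitting time is a convention. *)
Definition alpha (R : realType) (d : nat) (A P : 'M[R]_d) (T : Type)
    (X : nat -> T -> 'I_d) (j : 'I_d) (w : T) : R :=
  if hitting_time X j w is Some t then
    \prod_(1 <= l < t.+1)
      (A (X l.-1 w) (X l w) / P (X l.-1 w) (X l w))
  else 0.

Definition Zterm (R : realType) (d : nat) (A P : 'M[R]_d) (T : Type)
    (X : nat -> T -> 'I_d) (j : 'I_d) (w : T) (k : nat) : R :=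
  weight A P X k w * (X k w == j)%:R.

(* [series] is the sequence of partial sums; the limit is a dummy value where
   they diverge. *)
Definition Z (R : realType) (d : nat) (A P : 'M[R]_d) (T : Type)
    (X : nat -> T -> 'I_d) (j : 'I_d) (w : T) : R :=
  limn (series (Zterm A P X j w)).

(* Equality in law; the random variables may live on different spaces. *)
Definition same_distribution (R : realType) (d1 d2 : measure_display)
    (T1 : measurableType d1) (T2 : measurableType d2)
    (P1 : probability T1 R) (P2 : probability T2 R)
    (X1 : T1 -> R) (X2 : T2 -> R) : Prop :=
  [/\ measurable_fun setT X1, measurable_fun setT X2 &
      forall B : set R, measurable B -> P1 (X1 @^-1` B) = P2 (X2 @^-1` B)].

Definition independent_RV (R : realType) (disp : measure_display)
    (T : measurableType disp) (Q : probability T R) (U V : T -> R) : Prop :=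
  forall B1 B2 : set R, measurable B1 -> measurable B2 ->
    Q (U @^-1` B1 `&` V @^-1` B2) = (Q (U @^-1` B1) * Q (V @^-1` B2))%E.

(* Main.v *)
From HB Require Import structures.
From mathcomp Require Import all_boot all_order all_algebra.
From mathcomp Require Import all_classical all_reals all_analysis.
From mathcomp Require Import measurable_realfun complex ring lra.
Require Import Defs.

(** Along a path, the expectation of [|W_k 1_(X_k = j)|] is the [(i, j)] entry of
    [|A| ^ k], and the Cauchy-Schwarz inequality bounds its square by the product
    of the entries of [P ^ k] and [Hhat ^ k].  Since [rho Hhat < 1], these
    expectations decay geometrically, so [Z] converges absolutely almost surely
    and is integrable, and so is [alpha], which is one of the terms of the series.

    Everything else comes from conditioning on the first step.  The matrix of the
    expectations of [Z] satisfies [M = 1 + A M], hence [M = C]; conditioning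
    [alpha] in the same way, the defect [M i j - (i == j) - E(alpha^(ij)) M j j]
    is fixed by [A] with its [j]-th column removed, hence vanishes.  Likewise the
    laws of [c (Z_(ij) - (i == j))] and of [c alpha^(ij) Z_(jj)], with independent
    factors, satisfy the same first-step recursion, so that the supremum over [c]
    of the difference of their values at a given Borel set is a bounded function of
    [i] which is subharmonic for the chain killed at [j]; by the maximum principle
    it is zero.  This replaces the strong Markov property. *)

Set Implicit Arguments.
Unset Strict Implicit.
Unset Printing Implicit Defensive.

Import Order.TTheory GRing.Theory Num.Theory.
Import numFieldNormedType.Exports.
Local Open Scope classical_set_scope.
Local Open Scope ring_scope.

(** * Powers of matrices *)

(* The factors are peeled off one by one: if [|v k.+1 - z * v k|] is at most a
   multiple of [r ^+ k] and [|z| < r], then so is [|v k|]. *)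
Lemma powers_bound_of_roots (F : numFieldType) (n : nat) (H : 'M[F]_n.+1)
    (s : seq F) (r : F) :
  0 < r -> (forall z, z \in s -> `|z| < r) ->
  \prod_(z <- s) (H - z%:M) = 0 ->
  forall i j, exists B, forall k, `|(H ^+ k) i j| <= B * r ^+ k.
Proof.
move=> r0 sr s0.
(* Generalised for the induction on [s]: instead of vanishing, the product times [H ^+ k] is only of
   order [r ^+ k]. For an empty product this is the goal. *)
suff /(_ s sr) : forall s, (forall z, z \in s -> `|z| < r) ->
    (forall i j, exists B, forall k,
      `|((\prod_(z <- s) (H - z%:M)) * H ^+ k) i j| <= B * r ^+ k) ->
    forall i j, exists B, forall k, `|(H ^+ k) i j| <= B * r ^+ k.
  by apply=> i j; exists 0 => k; rewrite s0 mul0r mxE normr0 mul0r.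
elim=> [_ h i j|z {sr s0}s IH sr h].
  by have [B hB] := h i j; exists B => k; move: (hB k); rewrite big_nil mul1r.
apply: IH => [y ys|i j]; first by apply: sr; rewrite inE ys orbT.
have zr : `|z| < r by apply: sr; rewrite inE eqxx.
have [B hB] := h i j.
set M := \prod_(_ <- _) _ in h hB *.
pose v k := ((\prod_(z <- s) (H - z%:M)) * H ^+ k) i j.
have vE k : v k.+1 = z * v k + (M * H ^+ k) i j.
  rewrite /M big_cons mulrBl mulrBl.
  have comm : GRing.comm H (\prod_(z <- s) (H - z%:M)).
    elim/big_rec: _ => [|y N _ hN]; first exact: commr1.
    apply: commrM => //; apply: commrB; first exact: commr_refl.
    by rewrite /GRing.comm; exact: scalar_mxC.
  rewrite comm -[_ * H * _]mulrA -exprS [in RHS]mxE /v [X in _ + (_ + X)]mxE.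
  rewrite -mulrA -[_%:M * _]/(_ *m _) mul_scalar_mx [in X in _ + (_ - X)]mxE.
  by ring.
have B0 : 0 <= B.
  by have := hB 0%N; rewrite !expr0 ?mulr1; move/(le_trans (normr_ge0 _)).
have zr0 : 0 < r - `|z| by rewrite subr_gt0.
(* A constant [c] passes from [k] to [k.+1] as soon as [c * (r - |z|)] is at least [B]; the summand
   [|v 0|] settles [k = 0]. *)
exists (`|v 0%N| + B / (r - `|z|)); elim=> [|k IHk].
  by rewrite -/(v 0%N) expr0 mulr1 lerDl divr_ge0 // ltW.
rewrite -/(v k.+1) vE (le_trans (ler_normD _ _))//.
rewrite (le_trans (lerD _ (hB k))
  (y := `|z| * ((`|v 0%N| + B / (r - `|z|)) * r ^+ k) + B * r ^+ k))//.
  by rewrite normrM ler_wpM2l.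
rewrite exprS mulrA [X in _ <= X]mulrA -mulrDl ler_pM2r ?exprn_gt0//.
rewrite -subr_ge0 [X in 0 <= X](_ : _ = (r - `|z|) * `|v 0%N|).
  by rewrite mulr_ge0 // ltW.
by field; rewrite gt_eqF.
Qed.

(** Over [R[i]] the characteristic polynomial splits, and by Cayley-Hamilton the product of the
    factors [H - z] vanishes. All roots have modulus below any [r] larger than the spectral
    radius. *)
Lemma spectral_radius_powers (R : realType) (d : nat) (H : 'M[R]_d) :
  spectral_radius H < 1 ->
  exists r B : R, [/\ 0 < r < 1, 0 <= B &
    forall k i j, `|(H ^+ k) i j| <= B * r ^+ k].
Proof.
case: d H => [H _|n H rH].
  by exists (1 / 2), 0; split=> [|//|k []//]; lra.
set rho := spectral_radius H in rH.
(* The midpoint between the spectral radius and 1; the maximum with 0 makes [r] positive at once. *)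
pose r := (Num.max rho 0 + 1) / 2.
have [r0 r1 rhor] : [/\ 0 < r, r < 1 & rho < r].
  by rewrite /r; case: (ltP rho 0) => ?; split; lra.
pose HC := map_mx (real_complex R) H.
have [s sE] := closed_field_poly_normal (char_poly HC).
move: sE; rewrite (monicP (char_poly_monic _)) scale1r => sE.
have sP z : z \in s -> eigenvalue HC z.
  by rewrite eigenvalue_root_char sE root_prod_XsubC.
have sup_ub z : z \in s -> complex.Re `|z| < r.
  move=> zs; apply: le_lt_trans rhor; rewrite /rho /spectral_radius.
  apply: sup_ubound; last by exists z => //; exact: sP.
  (* The set of moduli has to be bounded for [sup] to dominate its elements; the sum of all the
     moduli is a bound. *)
  exists (\sum_(y <- s) complex.Re `|y|) => _ [y yP <-].
  have : y \in s by rewrite -root_prod_XsubC -sE -eigenvalue_root_char.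
  have Re0 (x : R[i]) : 0 <= complex.Re `|x|.
    by have := normr_ge0 x; rewrite lecE => /andP[].
  elim: {sE sP zs}s => // x s IH; rewrite inE big_cons => /orP[/eqP<-|/IH h].
    by rewrite lerDl sumr_ge0.
  by rewrite (le_trans h)// lerDr.
have norm_real (x : R[i]) : `|x| = (complex.Re `|x|)%:C%C.
  by rewrite normc_def.
have [|B hB] := @boolp.choice ('I_n.+1 * 'I_n.+1) R[i]
    (fun ij B => forall k, `|(HC ^+ k) ij.1 ij.2| <= B * (r%:C%C) ^+ k).
  move=> [i j]; apply: (@powers_bound_of_roots _ _ _ s) => [|z zs|].
  - by rewrite ltcR.
  - by rewrite norm_real ltcR; exact: sup_ub.
  - have := Cayley_Hamilton HC; rewrite sE rmorph_prod => h; rewrite -[RHS]h.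
    by apply: eq_bigr => z _; rewrite rmorphB /= horner_mx_X horner_mx_C.
have Hk k i j : complex.Re `|(HC ^+ k) i j| = `|(H ^+ k) i j|.
  have -> : HC ^+ k = map_mx (real_complex R) (H ^+ k) by rewrite rmorphXn.
  by rewrite mxE normc_def /= expr0n addr0 sqrtr_sqr.
have hB' k i j : `|(H ^+ k) i j| <= complex.Re (B (i, j)) * r ^+ k.
  have := hB (i, j) k.
  rewrite norm_real Hk -[(r%:C)%C ^+ k](rmorphXn (real_complex R)) lecE /=.
  move=> /andP[_].
  case: (B (i, j)) => a b /=; lra.
(* Summing the constants of all the entries gives one constant for every [i] and [j]. *)
exists r, (\sum_ij complex.Re (B ij)); split; first by rewrite r0.
  apply: sumr_ge0 => -[i j] _; have := hB' 0%N i j.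
  by rewrite !expr0 ?mulr1; move/(le_trans (normr_ge0 _)).
move=> k i j; rewrite (le_trans (hB' k i j))// ler_wpM2r ?exprn_ge0 ?(ltW r0)//.
rewrite (bigD1 (i, j))//= lerDl; apply: sumr_ge0 => -[i' j'] _.
by have := hB' 0%N i' j'; rewrite !expr0 ?mulr1; move/(le_trans (normr_ge0 _)).
Qed.

(** The Cauchy-Schwarz inequality in a form free of square roots. *)
Lemma sqr_sum_le (R : realDomainType) (I : Type) (s : seq I) (a p h : I -> R) :
  (forall i, 0 <= p i) -> (forall i, 0 <= h i) ->
  (forall i, a i ^+ 2 <= p i * h i) ->
  (\sum_(i <- s) a i) ^+ 2 <= (\sum_(i <- s) p i) * (\sum_(i <- s) h i).
Proof.
move=> p0 h0 aph; elim: s => [|x s IH]; first by rewrite !big_nil expr0n mul0r.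
rewrite !big_cons; set S := \sum_(j <- s) a j in IH *.
set p' := \sum_(j <- s) p j in IH *; set h' := \sum_(j <- s) h j in IH *.
have p'0 : 0 <= p' by exact: sumr_ge0.
have h'0 : 0 <= h' by exact: sumr_ge0.
have := aph x; have := p0 x; have := h0 x.
move: (a x) (p x) (h x) => b q k k0 q0 bqk.
(* Arithmetic-geometric mean inequality for [q * h'] and [p' * k], whose product bounds the square
   of [b * S]. *)
have cross : 2 * (b * S) <= q * h' + p' * k.
  apply: le_trans (ler_norm _) _.
  rewrite -ler_sqr ?nnegrE ?addr_ge0 ?mulr_ge0// -normrX ger0_norm ?sqr_ge0//.
  have : b ^+ 2 * S ^+ 2 <= (q * k) * (p' * h').
    by apply: ler_pM => //; exact: sqr_ge0.
  have := sqr_ge0 (q * h' - p' * k); nra.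
nra.
Qed.

Lemma stochasticX (R : realType) (d : nat) (P : 'M[R]_d) (n : nat) :
  stochastic P -> stochastic (P ^+ n).
Proof.
move=> [P0 P1]; elim: n => [|n [Pn0 Pn1]].
  split=> i *; rewrite expr0; first by rewrite mxE ler0n.
  under eq_bigr do rewrite mxE.
  rewrite (bigD1 i)//= eqxx big1 ?addr0// => j.
  by rewrite eq_sym => /negbTE->.
split=> i *; rewrite exprS.
  by rewrite mxE sumr_ge0// => k _; rewrite mulr_ge0.
under eq_bigr do rewrite mxE.
rewrite exchange_big/= -[RHS](P1 i); apply: eq_bigr => k _.
by rewrite -mulr_sumr Pn1 mulr1.
Qed.

Lemma mxabs_powers (R : realType) (d : nat) (A P : 'M[R]_d) :
  stochastic P -> (forall i j, 0 < P i j <-> A i j != 0) ->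
  spectral_radius (Hhat A P) < 1 ->
  exists q C : R, [/\ 0 < q < 1, 0 <= C &
    forall k i j, 0 <= (map_mx Num.norm A ^+ k) i j <= C * q ^+ k].
Proof.
move=> Ps AP /spectral_radius_powers[r [B [/andP[r0 r1] B0 HB]]].
have H0 i j : 0 <= Hhat A P i j.
  by rewrite mxE; case: ifP => // _; rewrite divr_ge0 ?sqr_ge0//; case: Ps.
have X0 (M : 'M[R]_d) k i j : (forall i j, 0 <= M i j) -> 0 <= (M ^+ k) i j.
  move=> M0; elim: k i j => [|k IH] i j; first by rewrite expr0 mxE ler0n.
  by rewrite exprS mxE sumr_ge0// => l _; rewrite mulr_ge0.
have A2 i j : map_mx Num.norm A i j ^+ 2 <= P i j * Hhat A P i j.
  rewrite !mxE real_normK ?num_real//; case: eqVneq => [Pij|Pij] /=.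
    have [->|/AP] := eqVneq (A i j) 0; first by rewrite expr0n mulr0.
    by rewrite Pij ltxx.
  by rewrite mulrC divfK.
have cs k i j : (map_mx Num.norm A ^+ k) i j ^+ 2 <=
    (P ^+ k) i j * (Hhat A P ^+ k) i j.
  elim: k i j => [|k IH] i j.
    by rewrite !expr0 mxE; case: eqP => _; rewrite /= ?expr1n ?expr0n ?mulr1 ?mulr0.
  rewrite !(exprS _ k) [X in X ^+ 2]mxE
    [X in _ <= X * _]mxE [X in _ <= _ * X]mxE; apply: sqr_sum_le => l.
  - by rewrite mulr_ge0//; [case: Ps|case: (stochasticX k Ps)].
  - by rewrite mulr_ge0// X0.
  - rewrite exprMn [leRHS]mulrACA.
    by apply: ler_pM; rewrite ?sqr_ge0 ?A2 ?IH.
(* The entries of [P ^+ k] are at most 1, so [cs] bounds the square by [B * r ^+ k]. *)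
exists (Num.sqrt r), (Num.sqrt B); split.
- by rewrite sqrtr_gt0 r0 /= -[X in _ < X]sqrtr1 ltr_sqrt.
- exact: sqrtr_ge0.
move=> k i j; have a0 : 0 <= (map_mx Num.norm A ^+ k) i j.
  by apply: X0 => ? ?; rewrite mxE.
rewrite a0 /= -ler_sqr ?nnegrE ?mulr_ge0 ?exprn_ge0 ?sqrtr_ge0//.
rewrite exprMn -exprM mulnC exprM !sqr_sqrtr ?(ltW r0)//.
apply: le_trans (cs k i j) _; have [Pk0 Pk1] := stochasticX k Ps.
apply: le_trans (le_trans (ler_norm _) (HB k i j)).
rewrite ler_piMl ?X0// -(Pk1 i) (bigD1 j)//= lerDl.
exact: sumr_ge0.
Qed.

(** Iterating the inequality bounds [|v i|] by row [i] of [M ^+ k] applied to [|v|], which tends to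
    0 like [q ^+ k]. *)
Lemma contraction_fixpoint_eq0 (R : realType) (d : nat) (M : 'M[R]_d) (q C : R)
    (v : 'I_d -> R) :
  0 < q < 1 -> (forall k i j, 0 <= (M ^+ k) i j <= C * q ^+ k) ->
  (forall i, `|v i| <= \sum_j M i j * `|v j|) -> forall i, v i = 0.
Proof.
move=> /andP[q0 q1] MC vM i; apply/eqP; rewrite -normr_le0.
have vk k : `|v i| <= \sum_j (M ^+ k) i j * `|v j|.
  elim: k => [|k IH].
    rewrite expr0 (bigD1 i)//= mxE eqxx mul1r lerDl sumr_ge0// => j _.
    by rewrite mulr_ge0// mxE ler0n.
  apply: le_trans IH _; rewrite exprSr.
  under [leRHS]eq_bigr do rewrite mxE mulr_suml.
  rewrite exchange_big/=; apply: ler_sum => l _.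
  under eq_bigr do rewrite -mulrA.
  by rewrite -mulr_sumr ler_wpM2l//; case/andP: (MC k i l).
have qn : `|q| < 1 by rewrite ger0_norm// ltW.
have cvq := @cvg_geometric R (C * \sum_j `|v j|) q qn.
rewrite -(cvg_lim (@Rhausdorff R) cvq); apply: limr_ge; first exact: cvgP cvq.
near=> k; rewrite /= mulrAC;  apply: le_trans (vk k) _; rewrite mulr_sumr.
by apply: ler_sum => j _; rewrite ler_wpM2r//; case/andP: (MC k i j).
Unshelve. all: by end_near. Qed.

(** [irreducible_chain] may be witnessed by zero steps when [i = j]. Moving first to some successor
    of [i], which exists because the row sums to 1, makes the time positive. *)
Lemma irreducible_hits (R : realType) (d : nat) (P : 'M[R]_d) (i j : 'I_d) :
  stochastic P -> irreducible_chain P -> exists n, 0 < (P ^+ n.+1) i j.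
Proof.
move=> [P0 P1] Pirr.
have [l Pil] : exists l, 0 < P i l.
  apply: contrapT => /forallNP Pi; have := P1 i.
  rewrite big1 => [/esym/eqP|l _]; first by rewrite oner_eq0.
  apply/eqP; rewrite eq_le P0 andbT.
  by rewrite leNgt; apply/negP/Pi.
have [n Pn] := Pirr l j; exists n; rewrite exprS mxE (bigD1 l)//=.
rewrite ltr_wpDr ?mulr_gt0// sumr_ge0// => k _.
by rewrite mulr_ge0//; case: (stochasticX n (conj P0 P1)).
Qed.

(* Maximum principle: at a point where [u] attains a positive maximum, all the
   successors avoid [j] and attain it too, which contradicts irreducibility. *)
Lemma killed_subharmonic_le0 (R : realType) (d : nat) (P : 'M[R]_d) (j : 'I_d)
    (u : 'I_d -> R) :
  stochastic P -> irreducible_chain P ->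
  (forall i, u i <= \sum_(l | l != j) P i l * u l) -> forall i, u i <= 0.
Proof.
move=> Ps Pirr uP i; have [P0 P1] := Ps.
have [m um] : exists m, forall l, u l <= u m.
  by case: (arg_maxP u (isT : xpredT i)) => m _ h; exists m => l; exact: h.
apply: le_trans (um i) _; rewrite leNgt; apply/negP => um0.
have step x l : u x = u m -> 0 < P x l -> l != j /\ u l = u m.
  move=> xm Pxl.
  (* Since the row sums to 1, subharmonicity at a maximum says that a sum of nonnegative terms is at
     most 0, so each term vanishes. *)
  have le1 : \sum_(y | y != j) P x y * (u m - u y) + P x j * u m <= 0.
    have := uP x; rewrite xm; under [in X in _ -> X]eq_bigr do rewrite mulrBr.
    rewrite sumrB -mulr_suml => ux.
    have -> : \sum_(y | y != j) P x y = 1 - P x j.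
      by rewrite -(P1 x) [in RHS](bigD1 j)//= addrAC subrr add0r.
    by move: ux; set S := \sum_(_ | _) _; lra.
  have ge0 y : 0 <= P x y * (u m - u y) by rewrite mulr_ge0// subr_ge0 um.
  have lj : l != j.
    apply/eqP => lj; move: le1; rewrite -lj.
    have : 0 < P x l * u m by rewrite mulr_gt0.
    have : 0 <= \sum_(y | y != l) P x y * (u m - u y) by rewrite sumr_ge0.
    by lra.
  split=> //; move: le1; rewrite (bigD1 l)//=.
  have : 0 <= \sum_(y | (y != j) && (y != l)) P x y * (u m - u y).
    by rewrite sumr_ge0.
  have : 0 <= P x j * u m by rewrite mulr_ge0// ltW.
  move=> h1 h2 h3; have : P x l * (u m - u l) <= 0 by lra.
  rewrite pmulr_rle0// subr_le0 => uml; apply/eqP.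
  by rewrite eq_le uml um.
have [n] := irreducible_hits m j Ps Pirr.
have : forall n x y, u x = u m -> 0 < (P ^+ n.+1) x y -> y != j /\ u y = u m.
  elim=> [|{}n IH] x y xm; first by rewrite expr1; exact: step.
  rewrite exprS mxE => sum0.
  have [l hl] : exists l, 0 < P x l * (P ^+ n.+1) l y.
    apply: contrapT => /forallNP hN; move: sum0; rewrite ltNge => /negP; apply.
    by apply: sumr_le0 => l _; rewrite leNgt; apply/negP/hN.
  have Pxl : 0 < P x l.
    by rewrite lt_def P0 andbT; apply: contraTneq hl => ->; rewrite mul0r ltxx.
  have [_ ul] := step x l xm Pxl; apply: IH ul _.
  by rewrite -(pmulr_rgt0 _ Pxl).
by move=> /[apply] - /(_ erefl)[]; rewrite eqxx.
Qed.
(** * The space of trajectories *)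

Definition cylinder (d n : nat) (s : nat -> 'I_d) : set (nat -> 'I_d) :=
  [set x | forall k, (k < n)%N -> x k = s k].

(* Cylinders of length at least 2 already generate the sigma-algebra, and on them
   the Markov property at time 1 is a mere product formula. *)
Definition cylinders (d : nat) : set (set (nat -> 'I_d)) :=
  [set E | [\/ E = set0, E = setT | exists n s, E = cylinder n.+2 s]].

(* The parameter only serves to make the type of sequences pointed. *)
Definition pointed_seq (d : nat) (i : 'I_d) := nat -> 'I_d.

HB.instance Definition _ (d : nat) (i : 'I_d) :=
  Choice.on (pointed_seq i).
HB.instance Definition _ (d : nat) (i : 'I_d) :=
  isPointed.Build (pointed_seq i) (fun=> i).

Notation path_space i :=
  (g_sigma_algebraType (@cylinders _ : set (set (pointed_seq i)))).

Definition eval_at (d : nat) (k : nat) (x : nat -> 'I_d) : 'I_d := x k.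

Definition path_of (d : nat) (T : Type) (X : nat -> T -> 'I_d) (w : T) :
  nat -> 'I_d := fun k => X k w.

(** * Measurability of the coordinates, the weights and [Z] *)

Section Measurability.
Context (R : realType) (d : nat).

(** Of two cylinders that meet, the longer is contained in the shorter. Stability under intersection
    is what uniqueness of measures requires of a generating family. *)
Lemma setI_closed_cylinders : setI_closed (@cylinders d).
Proof.
move=> A B [->|->|[n [s ->]]] [->|->|[m [t ->]]];
  rewrite ?set0I ?setI0 ?setTI ?setIT;
  try by [constructor 1|constructor 2|constructor 3; do 2 eexists].
have cylS n' m' s' t' : (n' <= m')%N ->
    (exists x, (cylinder n' s' `&` cylinder m' t') x) ->
    cylinder n' s' `&` cylinder m' t' = cylinder m' t'.
  move=> nm [x [xs xt]]; apply/seteqP; split=> [y []//|y yt]; split=> // k kn.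
  by rewrite yt ?(leq_trans kn)// -xt ?(leq_trans kn)// xs.
have [E|/set0P[x AB]] := eqVneq (cylinder n.+2 s `&` cylinder m.+2 t) set0.
  by constructor 1.
constructor 3; have [nm|/ltnW mn] := leqP n m.
  by exists m, t; apply: cylS => //; exists x.
by exists n, s; rewrite setIC; apply: cylS => //; exists x; rewrite setIC.
Qed.

Lemma measurable_coord (i : 'I_d) (k : nat) (j : 'I_d) :
  measurable ([set x | eval_at k x = j] : set (path_space i)).
Proof.
(* Finite words are countable, and a cylinder of length [k.+2] both fixes the coordinate [k] and is
   one of the generators. *)
pose F (w : seq 'I_d) : set (path_space i) :=
  if nth i w k == j then cylinder k.+2 (nth i w) else set0.
rewrite [X in measurable X](_ : _ = \bigcup_w F w); last first.
  apply/seteqP; split=> [x xj|x [w _]].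
    exists (mkseq x k.+2) => //; rewrite /F nth_mkseq// ifT; last exact/eqP.
    by move=> l lk; rewrite nth_mkseq.
  by rewrite /F; case: eqP => // wj xw; rewrite /eval_at/= -wj; exact: xw.
apply: countable_bigcupT_measurable => [|w]; first exact: countableP.
apply: sub_sigma_algebra.
by rewrite /F; case: ifP => _; [constructor 3; do 2 eexists|constructor 1].
Qed.

Context (disp : measure_display) (T : measurableType disp).
Variables (A P : 'M[R]_d) (X : nat -> T -> 'I_d).
Hypothesis mX : forall k j, measurable [set w | X k w = j].

Lemma measurable_path_of (i : 'I_d) :
  measurable_fun setT (path_of X : T -> path_space i).
Proof.
apply: (@measurability _ _ T (path_space i) setT _ (@cylinders d)) => //.
move=> _ [B [->|->|[n [s ->]]] <-]; rewrite setTI ?preimage_set0 ?preimage_setT//.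
rewrite [X in measurable X](_ : _ =
    \bigcap_(k in [set k | (k < n.+2)%N]) [set w | X k w = s k]) //.
by apply: bigcap_measurableType => k _; exact: mX.
Qed.

Lemma measurable_state (f : 'I_d -> 'I_d -> R) (k l : nat) :
  measurable_fun setT (fun w => f (X k w) (X l w)).
Proof.
rewrite (_ : (fun w => _) = (fun w => \sum_a \sum_b
    f a b * (\1_[set w | X k w = a] w * \1_[set w | X l w = b] w))).
  apply: measurable_sum => a; apply: measurable_sum => b.
  by apply: measurable_funM => //; apply: measurable_funM; exact: measurable_indic.
apply/funext => w; rewrite (bigD1 (X k w))//= (bigD1 (X l w))//=.
rewrite !indicE !mem_set// !mulr1 big1 ?addr0 => [|b bX]; last first.
  by rewrite indicE memNset ?mulr0// => /esym/eqP; apply/negP.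
rewrite big1 ?addr0// => a aX; apply: big1 => b _.
by rewrite indicE memNset ?mul0r ?mulr0// => /esym/eqP; apply/negP.
Qed.

Lemma measurable_weight (k : nat) : measurable_fun setT (weight A P X k).
Proof.
elim: k => [|k IH]; first exact: measurable_cst.
apply: measurable_funM => //.
exact: (measurable_state (fun a b => A a b / P a b)).
Qed.

Lemma measurable_Zterm (j : 'I_d) (k : nat) :
  measurable_fun setT (fun w => Zterm A P X j w k).
Proof.
apply: measurable_funM; first exact: measurable_weight.
exact: (measurable_state (fun a _ => (a == j)%:R) k k).
Qed.

(** A real sequence converges exactly when its upper and lower limits in the extended reals coincide
    and are finite; both limits are measurable in [w]. *)
Lemma measurable_cvgn (u : nat -> T -> R) :
  (forall n, measurable_fun setT (u n)) ->
  measurable [set w | cvgn (u ^~ w)].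
Proof.
move=> mu; pose v w n := (u n w)%:E.
have mv n : measurable_fun setT (v ^~ n) by exact/measurable_EFinP.
have msup : measurable_fun setT (fun w => limn_esup (v w)).
  exact: measurable_fun_limn_esup.
have minf : measurable_fun setT (fun w => limn_einf (v w)).
  rewrite (_ : (fun w => _) = (fun w => - limn_esup (fun n => - v w n))%E).
    apply: measurableT_comp => //; apply: measurable_fun_limn_esup => n.
    exact: measurableT_comp.
  apply/funext => w; rewrite -[LHS]oppeK; congr (- _)%E.
  by rewrite -limn_esupN.
rewrite [X in measurable X](_ : _ =
    (setT `&` [set w | limn_esup (v w) = limn_einf (v w)]) `&`
    (setT `&` [set w | limn_esup (v w) \is a fin_num])).
  by apply: measurableI; [exact: measurable_eqe|exact: emeasurable_fin_num].
rewrite !setTI; apply/seteqP; split=> w /=.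
  move=> cu; have : v w @ \oo --> (limn (u ^~ w))%:E.
    by apply/fine_cvgP; split; [exact: nearW|exact: cu].
  by move=> /cvg_limn_einf_sup[-> ->].
case=> supinf supfin.
have vsup : v w @ \oo --> limn_esup (v w).
  apply: (@squeeze_cvge _ _ _ _ (einfs (v w)) (v w) (esups (v w))).
  - near=> n; apply/andP; split; last first.
      by apply: ereal_sup_ubound; exists n => //=.
    by apply: ereal_inf_lbound; exists n => //=.
  - rewrite supinf limn_einf_lim; exact: is_cvg_einfs.
  - rewrite limn_esup_lim; exact: is_cvg_esups.
by move: vsup; rewrite -(fineK supfin) => /fine_cvgP[_ /cvgP].
Unshelve. all: by end_near. Qed.

(** [limn] is a limit of measurable functions only where the series converges; on the complement it
    is a constant default value. *)
Lemma measurable_Z (j : 'I_d) : measurable_fun setT (Z A P X j).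
Proof.
pose u n w := series (Zterm A P X j w) n.
have mu n : measurable_fun setT (u n).
  rewrite /u /series /=; apply: measurable_sum => k; exact: measurable_Zterm.
have mE := measurable_cvgn mu; rewrite -(setUv [set w | cvgn (u ^~ w)]).
apply/measurable_funU => //; first exact: measurableC.
split.
  apply: (@measurable_fun_cvg _ _ _ _ u) => [n|w].
    exact: measurable_funTS.
  by [].
apply: (@eq_measurable_fun _ _ _ _ _ (cst point)) => [w|]; last first.
  exact: measurable_cst.
by rewrite inE => /dvgP.
Qed.

End Measurability.

(** * Hitting times and the weight accumulated until them *)

Section HittingTime.
Context (R : realType) (d : nat) (A P : 'M[R]_d) (T : Type).
Implicit Types (X : nat -> T -> 'I_d).

Lemma hitting_time_SomeP X j w t : hitting_time X j w = Some t <->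
  [/\ (0 < t)%N, X t w = j & forall s, (0 < s < t)%N -> X s w <> j].
Proof.
rewrite /hitting_time; case: pselect => [h|nh]; last first.
  by split=> // -[t0 Xt _]; case: nh; exists t; rewrite t0 Xt eqxx.
case: ex_minnP => m /andP[m0 /eqP Xm] mmin; split=> [[<-]|[t0 Xt tmin]].
  split=> // s /andP[s0 sm] Xs; have := mmin s.
  by rewrite s0 Xs eqxx leqNgt sm => /(_ isT).
congr Some; apply/eqP; rewrite eqn_leq mmin ?t0 ?Xt ?eqxx//= leqNgt.
by apply/negP => mt; apply: (tmin m) => //; rewrite m0.
Qed.

Lemma hitting_time_NoneP X j w : hitting_time X j w = None <->
  forall t, (0 < t)%N -> X t w <> j.
Proof.
rewrite /hitting_time; case: pselect => [h|nh]; split=> //.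
  by move=> H; have [t /andP[t0 /eqP]] := h; have := H t t0.
by move=> _ t t0 Xt; apply: nh; exists t; rewrite t0 Xt eqxx.
Qed.

Lemma weightE X k w : weight A P X k w =
  \prod_(1 <= l < k.+1) (A (X l.-1 w) (X l w) / P (X l.-1 w) (X l w)).
Proof.
elim: k => [|k IH]; first by rewrite big_geq.
by rewrite big_nat_recr//= IH.
Qed.

Lemma alphaE X j w : alpha A P X j w =
  if hitting_time X j w is Some t then weight A P X t w else 0.
Proof. by rewrite /alpha; case: hitting_time => // t; rewrite weightE. Qed.

End HittingTime.

Lemma measurable_hitting_time (disp : measure_display)
    (T : measurableType disp) (d : nat) (X : nat -> T -> 'I_d)
    (mX : forall k j, measurable [set w | X k w = j]) (j : 'I_d)
    (o : option nat) :
  measurable [set w | hitting_time X j w = o].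
Proof.
have mNX k : measurable [set w | X k w <> j] by apply: measurableC; exact: mX.
case: o => [[|t]|].
- rewrite [X in measurable X](_ : _ = set0)//; apply/seteqP; split=> // w.
  by move=> /hitting_time_SomeP[].
- rewrite [X in measurable X](_ : _ = [set w | X t.+1 w = j] `&`
      \bigcap_(s in [set s | 0 < s < t.+1]%N) [set w | X s w <> j]).
    by apply: measurableI => //; apply: bigcap_measurableType => s _; exact: mNX.
  by apply/seteqP; split=> w; [move=> /hitting_time_SomeP[]|
    move=> [? ?]; apply/hitting_time_SomeP].
- rewrite [X in measurable X](_ : _ =
      \bigcap_(s in [set s | 0 < s]%N) [set w | X s w <> j]).
    by apply: bigcap_measurableType => s _; exact: mNX.
  apply/seteqP; split=> w => [/hitting_time_NoneP //|?].
  exact/hitting_time_NoneP.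
Qed.

Lemma measurable_alpha (R : realType) (d : nat) (disp : measure_display)
    (T : measurableType disp) (A P : 'M[R]_d) (X : nat -> T -> 'I_d)
    (mX : forall k j, measurable [set w | X k w = j]) (j : 'I_d) :
  measurable_fun setT (alpha A P X j).
Proof.
(* A countable partition: [0] stands for an infinite time and [t.+1] for the time [t]. On each piece
   [alpha] is 0 or a fixed [weight]. *)
pose E n := [set w | hitting_time X j w = (if n is t.+1 then Some t else None)].
rewrite (_ : setT = \bigcup_n E n); last first.
  apply/seteqP; split=> // w _; case Et : (hitting_time X j w) => [t|].
    by exists t.+1.
  by exists 0%N.
apply/measurable_fun_bigcup => [n|[|t]]; first exact: measurable_hitting_time.
  apply: (@eq_measurable_fun _ _ _ _ _ (cst (0 : R))) => [w|]; last first.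
    exact: measurable_cst.
  by rewrite inE => h; rewrite alphaE h.
apply: (@eq_measurable_fun _ _ _ _ _ (weight A P X t)) => [w|].
  by rewrite inE => h; rewrite alphaE h.
by apply: measurable_funTS; exact: measurable_weight.
Qed.

(** * Conditioning on the first step *)

Definition cons_path (d : nat) (i : 'I_d) (y : nat -> 'I_d) : nat -> 'I_d :=
  fun k => if k is k'.+1 then y k' else i.

Section PathFunctionals.
Context (R : realType) (d : nat) (A P : 'M[R]_d).
Implicit Types (i j : 'I_d) (x y : nat -> 'I_d).

(** The functionals depend on the outcome only through its trajectory. Read on the coordinate
    process, they can be compared for chains living on different spaces. *)
Lemma weight_path (T : Type) (X : nat -> T -> 'I_d) k w :
  weight A P X k w = weight A P (@eval_at d) k (path_of X w).
Proof. by elim: k => //= k ->. Qed.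

Lemma Zterm_path (T : Type) (X : nat -> T -> 'I_d) j w :
  Zterm A P X j w = Zterm A P (@eval_at d) j (path_of X w).
Proof. by apply/funext => k; rewrite /Zterm weight_path. Qed.

Lemma Z_path (T : Type) (X : nat -> T -> 'I_d) j w :
  Z A P X j w = Z A P (@eval_at d) j (path_of X w).
Proof. by rewrite /Z Zterm_path. Qed.

Lemma weight_cons i y k : weight A P (@eval_at d) k.+1 (cons_path i y) =
  A i (y 0%N) / P i (y 0%N) * weight A P (@eval_at d) k y.
Proof.
elim: k => [|k IH]; first by rewrite /= mulrC.
rewrite -[LHS]/(weight A P (@eval_at d) k.+1 (cons_path i y) *
  (A (y k) (y k.+1) / P (y k) (y k.+1))).
by rewrite IH -mulrA.
Qed.

Lemma Zterm_cons i j y k : Zterm A P (@eval_at d) j (cons_path i y) k.+1 =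
  A i (y 0%N) / P i (y 0%N) * Zterm A P (@eval_at d) j y k.
Proof. by rewrite /Zterm weight_cons mulrA. Qed.

Lemma Zterm0 i j y : Zterm A P (@eval_at d) j (cons_path i y) 0 = (i == j)%:R.
Proof. by rewrite /Zterm mul1r. Qed.

(** Splitting off the term of index 0 and factoring out the first ratio leaves the series along [y].
    Its convergence is assumed because [limn] is a dummy value on divergent series. *)
Lemma Z_cons i j y : cvgn (series (Zterm A P (@eval_at d) j y)) ->
  Z A P (@eval_at d) j (cons_path i y) =
  (i == j)%:R + A i (y 0%N) / P i (y 0%N) * Z A P (@eval_at d) j y.
Proof.
move=> cy; apply: (@cvg_lim _ (@Rhausdorff R)); rewrite -cvg_shiftS /=.
rewrite [X in X @ _ --> _](_ : _ = (fun n => (i == j)%:R +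
    A i (y 0%N) / P i (y 0%N) * series (Zterm A P (@eval_at d) j y) n)).
  by apply: cvgD; [exact: cvg_cst|apply: cvgM; [exact: cvg_cst|exact: cy]].
apply/funext => n /=; rewrite /series /= big_nat_recl// Zterm0 mulr_sumr.
by congr (_ + _); apply: eq_bigr => k _; rewrite Zterm_cons.
Qed.

Lemma hitting_time_None_cons i j y :
  hitting_time (@eval_at d) j (cons_path i y) = None <->
  y 0%N <> j /\ hitting_time (@eval_at d) j y = None.
Proof.
split=> [/hitting_time_NoneP h|[y0 /hitting_time_NoneP h]].
  by split; [exact: (h 1%N)|apply/hitting_time_NoneP => t t0; exact: (h t.+1)].
by apply/hitting_time_NoneP => -[|[|t]]// _; exact: h.
Qed.

(** Either the first step reaches [j] and the time is 1, or the hitting time of the tail is delayed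
    by one. If it is infinite, both sides are 0. *)
Lemma alpha_cons i j y : alpha A P (@eval_at d) j (cons_path i y) =
  A i (y 0%N) / P i (y 0%N) *
  (if y 0%N == j then 1 else alpha A P (@eval_at d) j y).
Proof.
rewrite !alphaE; case: eqP => [y0|y0].
  suff -> : hitting_time (@eval_at d) j (cons_path i y) = Some 1%N.
    by rewrite weight_cons.
  by apply/hitting_time_SomeP; split=> // -[|[|s]].
case Ey : (hitting_time _ j y) => [t|].
  suff -> : hitting_time (@eval_at d) j (cons_path i y) = Some t.+1.
    by rewrite weight_cons.
  move/hitting_time_SomeP : Ey => [t0 yt tmin].
  by apply/hitting_time_SomeP; split=> // -[|[|s]]// st; exact: tmin.
suff -> : hitting_time (@eval_at d) j (cons_path i y) = None by rewrite mulr0.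
exact/hitting_time_None_cons.
Qed.

End PathFunctionals.

(** Bundles the set function as a measure, so that uniqueness and integration results apply to
    it. *)
Lemma pushforward_measure_exists (R : realType) (d1 d2 : measure_display)
    (T1 : measurableType d1) (T2 : measurableType d2)
    (mu : {measure set T1 -> \bar R}) (f : T1 -> T2) :
  measurable_fun setT f ->
  exists m : {measure set T2 -> \bar R},
    m = pushforward mu f :> (set T2 -> \bar R).
Proof.
by move=> mf; unshelve (exists (pushforward mu f)).
Qed.

(** * The Markov property at time 1, for laws and for integrals *)

Section FirstStep.
Context (R : realType) (d : nat) (P : 'M[R]_d) (Ps : stochastic P).
Context (disp : 'I_d -> measure_display)
  (Omega : forall i, measurableType (disp i))
  (Pr : forall i, probability (Omega i) R)
  (X : forall i, nat -> Omega i -> 'I_d)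
  (X_chain : forall i, markov_chain (Pr i) P i (X i)).
Arguments X : clear implicits.

Lemma measurable_chain i k j : measurable [set w | X i k w = j].
Proof. by have [] := X_chain i. Qed.

Lemma chain_start i : {ae Pr i, forall w, X i 0 w = i}.
Proof.
have [mX X0 _] := X_chain i; exists (~` [set w | X i 0 w = i]); split=> //.
  exact/measurableC/mX.
by rewrite probability_setC// X0 subee.
Qed.

Lemma cylinder_prob i n s : Pr i (path_of (X i) @^-1` cylinder n.+1 s) =
  ((s 0%N == i)%:R * \prod_(0 <= k < n) P (s k) (s k.+1))%:E.
Proof.
have [mX X0 XS] := X_chain i; elim: n => [|n IH].
  rewrite big_geq// mulr1 [X in Pr i X](_ : _ = [set w | X i 0 w = s 0%N]).
    case: eqP => [->//|si].
    apply: subset_measure0 (_ : Pr i (~` [set w | X i 0 w = i]) = 0%E) => //.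
    - exact: measurableC.
    - by move=> w /= ->.
    - by rewrite probability_setC// X0 subee.
  by apply/seteqP; split=> w; [apply|move=> h [|//]].
rewrite big_nat_recr//= mulrA EFinM -IH; exact: XS.
Qed.

Local Notation chain_path i0 i := (path_of (X i) : Omega i -> path_space i0).
Local Notation step_path i0 i l :=
  (cons_path i \o path_of (X l) : Omega l -> path_space i0).

Lemma measurable_cons_path (i0 i l : 'I_d) : measurable_fun setT (step_path i0 i l).
Proof.
pose X' k w := if k is k'.+1 then X l k' w else i.
rewrite (_ : _ \o _ = path_of X'); last by apply/funext => w; apply/funext; case.
apply: measurable_path_of => -[|k] j /=; last exact: measurable_chain.
have [->|ij] := eqVneq i j.
  by rewrite (_ : [set _ | _] = setT)//; apply/seteqP; split.
rewrite (_ : [set _ | _] = set0)//; apply/seteqP; split=> // w /= /eqP.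
by rewrite (negbTE ij).
Qed.

Lemma measurable_path_chain (i0 i : 'I_d) :
  measurable_fun setT (chain_path i0 i).
Proof. by apply: measurable_path_of; exact: measurable_chain. Qed.

Lemma cons_path_cylinder i n s (y : nat -> 'I_d) :
  cylinder n.+1 s (cons_path i y) <->
  s 0%N = i /\ cylinder n (s \o S) y.
Proof.
split=> [h|[<- h] [|k]//]; last exact: h.
by split=> [|k kn]; [rewrite -(h 0%N)|exact: (h k.+1)].
Qed.

(* The law of the chain started at [i] is a mixture of laws of shifted chains; it
   is stated with [msum] so that integrals can be transported. *)
Lemma chain_first_step_measure (i0 i : 'I_d) :
  exists m : 'I_d -> {measure set (path_space i0) -> \bar R},
  (forall l, m l = pushforward (Pr l) (step_path i0 i l) :> (set _ -> _)) /\
  exists mu : nat -> {measure set (path_space i0) -> \bar R},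
  (forall l : 'I_d, mu l = mscale (NngNum (Ps.1 i l)) (m l)) /\
  forall E : set (path_space i0), measurable E ->
    Pr i (path_of (X i) @^-1` E) = msum mu d E.
Proof.
have [l|m mE] := @boolp.choice _ _
    (fun l (m : {measure set (path_space i0) -> \bar R}) =>
    m = pushforward (Pr l) (step_path i0 i l) :> (set _ -> _)).
  by apply: pushforward_measure_exists; exact: measurable_cons_path.
exists m; split=> //.
(* [msum] adds up a sequence of measures indexed by [nat], hence the zero measure from index [d]
   on. *)
pose mu (n : nat) : {measure set (path_space i0) -> \bar R} :=
  if insub n is Some l then mscale (NngNum (Ps.1 i l)) (m l) else mzero.
have muE (l : 'I_d) : mu l = mscale (NngNum (Ps.1 i l)) (m l).
  by rewrite /mu valK.
exists mu; split=> // E mE'.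
have [m1 m1E] : exists m1 : {measure set (path_space i0) -> \bar R},
    m1 = pushforward (Pr i) (chain_path i0 i) :> (set _ -> _).
  by apply: pushforward_measure_exists; exact: measurable_path_chain.
have msumE B : msum mu d B =
    (\sum_l (P i l)%:E * Pr l (step_path i0 i l @^-1` B))%E.
  rewrite /msum; apply: eq_bigr => l _; rewrite muE.
  by rewrite -[LHS]/((P i l)%:E * m l B)%E (mE l).
rewrite -[LHS]/(pushforward (Pr i) (chain_path i0 i) E) -m1E.
have m1T : m1 setT = 1%E by rewrite m1E /pushforward preimage_setT probability_setT.
(* Two finite measures that agree on the cylinders agree everywhere. *)
apply: (@measure_unique _ R (path_space i0) (@cylinders d) (fun=> setT) erefl
  (@setI_closed_cylinders d) _ _ m1 (msum mu d) _ _ E mE').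
- by move=> _; constructor 2.
- by rewrite bigcup_const//; exists 0%N.
- move=> B [->|->|[n [s ->]]]; first by rewrite !measure0.
    apply: etrans (esym (msumE _)); rewrite m1T -(Ps.2 i) -sumEFin.
    apply: eq_bigr => l _.
    by rewrite preimage_setT probability_setT mule1.
  apply: etrans (esym (msumE _)); rewrite m1E /pushforward cylinder_prob.
  (* Removing the first coordinate shortens the cylinder by one. Starting from length at least 2,
     what remains is nonempty, as [cylinder_prob] demands. *)
  have pre (l : 'I_d) : step_path i0 i l @^-1` cylinder n.+2 s =
      if s 0%N == i then path_of (X l) @^-1` cylinder n.+1 (s \o S) else set0.
    case: eqP => si; apply/seteqP; split=> w //=.
    + by case/cons_path_cylinder.
    + by move=> h; apply/cons_path_cylinder.
    + by case/cons_path_cylinder.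
  rewrite (eq_bigr (fun l => (P i l)%:E * Pr l (if s 0%N == i then
      path_of (X l) @^-1` cylinder n.+1 (s \o S) else set0))%E); last first.
    by move=> l _; congr (_ * Pr l _)%E; exact: pre.
  case: eqP => si; last by rewrite mul0r big1// => l _; rewrite measure0 mule0.
  rewrite (eq_bigr (fun l => (P i l * ((s 1%N == l)%:R *
      \prod_(0 <= k < n) P (s k.+1) (s k.+2)))%:E)); last first.
    by move=> l _; rewrite EFinM; congr (_ * _)%E; exact: cylinder_prob.
  rewrite sumEFin (bigD1 (s 1%N))//= eqxx !mul1r [X in _ + X]big1 ?addr0 => [|l ls].
    by rewrite big_nat_recl// si.
  by rewrite eq_sym (negbTE ls) mul0r mulr0.
- by move=> _; rewrite m1T ltry.
Qed.

(** Integration against the mixture of shifted laws. Here [g l] is [f] after prepending [i],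
    simplified by means of [X l 0 = l]; an almost sure equality is enough, which suits [Z_cons]. *)
Lemma ge0_integral_first_step (i0 i : 'I_d) (f : path_space i0 -> \bar R)
    (g : 'I_d -> path_space i0 -> \bar R) :
  measurable_fun setT f -> (forall x, 0 <= f x)%E ->
  (forall l, measurable_fun setT (g l)) -> (forall l x, 0 <= g l x)%E ->
  (forall l, {ae Pr l, forall w, X l 0 w = l ->
     f (cons_path i (path_of (X l) w)) = g l (path_of (X l) w)}) ->
  (\int[Pr i]_w f (path_of (X i) w) =
   \sum_l (P i l)%:E * \int[Pr l]_w g l (path_of (X l) w))%E.
Proof.
move=> mf f0 mg g0 fg.
have [m [mE [mu [muE Pmu]]]] := chain_first_step_measure i0 i.
have mp : measurable_fun setT (chain_path i0 i) by exact: measurable_path_chain.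
have ms l : measurable_fun setT (step_path i0 i l).
  by exact: measurable_cons_path.
have := ge0_integral_pushforward mp (Pr i) measurableT mf (fun y _ => f0 y).
rewrite preimage_setT => <-.
rewrite (@eq_measure_integral _ _ _ _ (msum mu d)); last first.
  by move=> E mE' _; exact: Pmu.
rewrite ge0_integral_measure_sum//; apply: eq_bigr => l _.
rewrite muE ge0_integral_mscale//; congr (_ * _)%E; rewrite mE.
rewrite (ge0_integral_pushforward (ms l) (Pr l) measurableT mf (fun y _ => f0 y)).
rewrite preimage_setT; apply: ge0_ae_eq_integral => //.
- exact: (measurableT_comp mf (ms l)).
- by apply: (measurableT_comp (mg l)); exact: measurable_path_chain.
- by move=> w _; exact: f0.
- rewrite /ae_eq.
  by apply: filterS2 (chain_start l) (fg l) => w w0 fgw _; exact: fgw.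
Qed.

(** Positive and negative parts are treated separately; integrability of each [g l] makes all the
    integrals finite, so that the differences recombine. *)
Lemma integral_first_step (i0 i : 'I_d) (f : path_space i0 -> \bar R)
    (g : 'I_d -> path_space i0 -> \bar R) :
  measurable_fun setT f -> (forall l, measurable_fun setT (g l)) ->
  (forall l, (Pr l).-integrable setT (g l \o path_of (X l))) ->
  (forall l, {ae Pr l, forall w, X l 0 w = l ->
     f (cons_path i (path_of (X l) w)) = g l (path_of (X l) w)}) ->
  (\int[Pr i]_w f (path_of (X i) w) =
   \sum_l (P i l)%:E * \int[Pr l]_w g l (path_of (X l) w))%E.
Proof.
move=> mf mg ig fg.
have stepp := @ge0_integral_first_step i0 i f^\+%E (fun l => (g l)^\+%E).
have stepn := @ge0_integral_first_step i0 i f^\-%E (fun l => (g l)^\-%E).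
have posE l : (\int[Pr l]_w (g l)^\+%E (path_of (X l) w))%E \is a fin_num.
  by have := integrable_pos_fin_num measurableT (ig l); rewrite funepos_comp.
have negE l : (\int[Pr l]_w (g l)^\-%E (path_of (X l) w))%E \is a fin_num.
  by have := integrable_neg_fin_num measurableT (ig l); rewrite funeneg_comp.
rewrite -[LHS]/(\int[Pr i]_w ((f \o path_of (X i)) w))%E integralE.
rewrite funepos_comp funeneg_comp stepp ?stepn; first last.
- by move=> l; apply: filterS (fg l) => w h /h fgw; rewrite !funeposE fgw.
- by move=> l x; rewrite funepos_ge0.
- by move=> l; exact: measurable_funepos.
- by move=> x; rewrite funepos_ge0.
- exact: measurable_funepos.
- by move=> l; apply: filterS (fg l) => w h /h fgw; rewrite !funenegE fgw.
- by move=> l x; rewrite funeneg_ge0.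
- by move=> l; exact: measurable_funeneg.
- by move=> x; rewrite funeneg_ge0.
- exact: measurable_funeneg.
pose a l := fine (\int[Pr l]_w (g l)^\+%E (path_of (X l) w))%E.
pose b l := fine (\int[Pr l]_w (g l)^\-%E (path_of (X l) w))%E.
have gE l : (\int[Pr l]_w g l (path_of (X l) w) = (a l - b l)%:E)%E.
  rewrite -[LHS]/(\int[Pr l]_w ((g l \o path_of (X l)) w))%E integralE.
  rewrite funepos_comp funeneg_comp EFinB.
  by congr (_ - _)%E; apply/esym/fineK.
have aE l : ((P i l)%:E * \int[Pr l]_w (g l)^\+%E (path_of (X l) w) =
    (P i l * a l)%:E)%E.
  by rewrite EFinM; congr (_ * _)%E; apply/esym/fineK.
have bE l : ((P i l)%:E * \int[Pr l]_w (g l)^\-%E (path_of (X l) w) =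
    (P i l * b l)%:E)%E.
  by rewrite EFinM; congr (_ * _)%E; apply/esym/fineK.
rewrite (eq_bigr _ (fun l _ => aE l)) (eq_bigr _ (fun l _ => bE l)).
rewrite !sumEFin -EFinB -sumrB -sumEFin; apply: eq_bigr => l _.
by rewrite gE -EFinM mulrBr.
Qed.

End FirstStep.
(** * Moments and laws of [Z] and [alpha] *)

Section Moments.
Context (R : realType) (d : nat) (A P : 'M[R]_d).
Hypotheses (Ps : stochastic P) (P_supp : forall i j, 0 < P i j <-> A i j != 0)
  (P_irr : irreducible_chain P) (rhoH : spectral_radius (Hhat A P) < 1).
Context (disp : 'I_d -> measure_display)
  (Omega : forall i, measurableType (disp i))
  (Pr : forall i, probability (Omega i) R)
  (X : forall i, nat -> Omega i -> 'I_d)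
  (X_chain : forall i, markov_chain (Pr i) P i (X i)).
Arguments X : clear implicits.

Local Notation Zc := (Z A P (@eval_at d)).
Local Notation Ztermc := (Zterm A P (@eval_at d)).
Local Notation alphac := (alpha A P (@eval_at d)).
Let absA := map_mx Num.norm A.

(** Where [P i l] is 0 the quotient is 0 by convention, and the support condition gives
    [A i l = 0]. *)
Lemma mulP_ratio i l : P i l * (A i l / P i l) = A i l.
Proof.
have [Pil|Pil] := eqVneq (P i l) 0; last by rewrite mulrC divfK.
have [->|/P_supp] := eqVneq (A i l) 0; first by rewrite mul0r mulr0.
by rewrite Pil ltxx.
Qed.

(** As a function of the start, the probability of never reaching [j] at a positive time is harmonic
    for the chain killed at [j]; the maximum principle makes it 0. *)
Lemma hitting_time_ae i j :
  {ae Pr i, forall w, hitting_time (X i) j w <> None}.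
Proof.
pose N : set (path_space i) := [set x | hitting_time (@eval_at d) j x = None].
have mN : measurable N.
  by apply: measurable_hitting_time => k l; exact: measurable_coord.
pose NX l : set (Omega l) := [set w | hitting_time (X l) j w = None].
have mNX l : measurable (NX l).
  by apply: measurable_hitting_time; exact: measurable_chain.
have intN l : (\int[Pr l]_w (\1_N (path_of (X l) w))%:E = Pr l (NX l))%E.
  by have := integral_indic (Pr l) measurableT (mNX l); rewrite setIT.
pose h l := fine (Pr l (NX l)).
have hE l : (h l)%:E = Pr l (NX l) by rewrite fineK// fin_num_measure.
have step l : (Pr l (NX l) =
    \sum_k (P l k)%:E * (if k == j then 0 else Pr k (NX k)))%E.
  rewrite -intN (ge0_integral_first_step Ps X_chain (i0 := i)
    (f := fun x => (\1_N x)%:E)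
    (g := fun k x => if k == j then 0%E else (\1_N x)%:E)).
  - apply: eq_bigr => k _; congr (_ * _)%E; case: eqP => // _.
    by rewrite integral0.
  - by apply/measurable_EFinP; exact: measurable_indic.
  - by move=> x; rewrite lee_fin.
  - move=> k; case: eqP => // _.
    by apply/measurable_EFinP; exact: measurable_indic.
  - by move=> k x; case: eqP => //; rewrite lee_fin.
  - move=> k; apply: aeW => w Xk; rewrite !indicE; case: eqP => kj.
      by rewrite memNset// => /hitting_time_None_cons[]; rewrite /path_of Xk.
    congr (_%:R%:E); congr nat_of_bool; apply/idP/idP; rewrite !inE.
      by move/hitting_time_None_cons => [].
    move=> H; apply/hitting_time_None_cons; split=> //.
    by rewrite /path_of Xk.
have h0 := @killed_subharmonic_le0 R d P j h Ps P_irr.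
have : h i <= 0.
  apply: h0 => l; have := step l; rewrite -hE.
  rewrite (eq_bigr (fun k => (P l k * (if k == j then 0 else h k))%:E)).
    rewrite sumEFin => -[->]; rewrite (bigD1 j)//= eqxx mulr0 add0r.
    by apply: ler_sum => k /negbTE ->.
  by move=> k _; rewrite EFinM -hE; case: eqP.
rewrite -lee_fin hE measure_le0 => /eqP PN.
by exists (NX i); split=> // w /contrapT.
Qed.

(** By induction on [k]: in the first step the probability [P i l] cancels the denominator of the
    ratio and leaves [|A i l|]. *)
Lemma expect_abs_Zterm (i0 i j : 'I_d) k :
  (\int[Pr i]_w (`|Ztermc j (path_of (X i) w) k|)%:E = ((absA ^+ k) i j)%:E)%E.
Proof.
have mZt k' : measurable_fun setT
    (fun x : path_space i0 => (`|Ztermc j x k'|)%:E).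
  apply/measurable_EFinP; apply: measurableT_comp => //.
  by apply: measurable_Zterm => n l; exact: measurable_coord.
have mpath l : measurable_fun setT (path_of (X l) : Omega l -> path_space i0).
  exact: measurable_path_chain.
elim: k i => [|k IH] i.
  transitivity (\int[Pr i]_w (cst ((i == j)%:R)%:E w))%E.
    apply: ae_eq_integral => //.
      exact: (measurableT_comp (mZt 0%N) (mpath i)).
    rewrite /ae_eq; apply: filterS (chain_start X_chain i) => w Xi _ /=.
    by rewrite /Zterm/= mul1r /eval_at /path_of Xi ger0_norm.
  rewrite integral_cst// [X in (_ * X)%E](@probability_setT _ _ _ (Pr i)).
  by rewrite mule1 expr0 mxE.
rewrite (ge0_integral_first_step Ps X_chain (i0 := i0)
    (f := fun x => (`|Ztermc j x k.+1|)%:E)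
    (g := fun l x => (`|A i l / P i l|%:E * (`|Ztermc j x k|)%:E)%E)) //.
- rewrite exprS mxE -sumEFin; apply: eq_bigr => l _.
  rewrite ge0_integralZl// ?IH; last first.
    exact: (measurableT_comp (mZt k) (mpath l)).
  rewrite -!EFinM mulrA; congr (_ * _)%:E.
  by rewrite mxE -[in RHS](mulP_ratio i l) [in RHS]normrM (ger0_norm (Ps.1 i l)).
- by move=> l; exact: measurable_funeM.
- by move=> l; apply: aeW => w Xl; rewrite Zterm_cons normrM {1 2}/path_of Xl EFinM.
Qed.

(** Sum and integral commute for nonnegative terms, and every partial sum of the geometric bound is
    at most [C / (1 - q)]. *)
Lemma expect_sum_abs_Zterm (i j : 'I_d) :
  (\int[Pr i]_w (\sum_(k <oo) (`|Ztermc j (path_of (X i) w) k|)%:E) < +oo)%E.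
Proof.
rewrite integral_nneseries//; last first.
  move=> k; apply/measurable_EFinP; apply: measurableT_comp => //.
  apply: (measurableT_comp (f := fun x : path_space i => Ztermc j x k)).
    by apply: measurable_Zterm => n l; exact: measurable_coord.
  exact: measurable_path_chain.
have [q [C [/andP[q0 q1] C0 AC]]] := mxabs_powers Ps P_supp rhoH.
under eq_eseriesr do rewrite (expect_abs_Zterm i).
apply: (@le_lt_trans _ _ ((C / (1 - q))%:E)); last exact: ltry.
apply: lime_le.
  by apply: is_cvg_nneseries => k _ _; rewrite lee_fin; case/andP: (AC k i j).
apply: nearW => n; rewrite sumEFin lee_fin.
apply: (@le_trans _ _ (\sum_(0 <= k < n) C * q ^+ k)).
  by apply: ler_sum => k _; case/andP: (AC k i j).
rewrite -mulr_sumr ler_wpM2l// big_mkord.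
have q1' : 0 < 1 - q by rewrite subr_gt0.
rewrite -[leRHS]mul1r ler_pdivlMr//.
have := subrX1 q n; set S := \sum_(k < n) _ => h.
have -> : S * (1 - q) = 1 - q ^+ n by rewrite -[RHS]opprB h; ring.
by rewrite gerBl exprn_ge0// ltW.
Qed.

Let sumZ j (x : nat -> 'I_d) : \bar R := (\sum_(k <oo) (`|Ztermc j x k|)%:E)%E.

Lemma sum_abs_Zterm_ge j x n :
  ((\sum_(0 <= k < n) `|Ztermc j x k|)%:E <= sumZ j x)%E.
Proof. by rewrite -sumEFin; apply: nneseries_lim_ge. Qed.

Lemma cvgn_normed_Zterm j x : (sumZ j x < +oo)%E ->
  cvgn [normed series (Ztermc j x)].
Proof.
move=> xoo; apply: nondecreasing_is_cvgn.
  by apply: nondecreasing_series => k _ _ /=.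
exists (fine (sumZ j x)) => _ [n _ <-] /=.
rewrite -lee_fin fineK ?sum_abs_Zterm_ge// ge0_fin_numE//.
by apply: nneseries_ge0.
Qed.

Lemma integrable_sumZ i j : (Pr i).-integrable setT (sumZ j \o path_of (X i)).
Proof.
have s0 x : (0 <= sumZ j x)%E by apply: nneseries_ge0.
apply/integrableP; split.
  apply: (measurableT_comp (f := sumZ j : path_space i -> \bar R)); last first.
    exact: measurable_path_chain.
  apply: ge0_emeasurable_sum => // k _.
  apply/measurable_EFinP; apply: measurableT_comp => //.
  by apply: measurable_Zterm => n l; exact: measurable_coord.
rewrite (eq_integral (sumZ j \o path_of (X i))).
  exact: expect_sum_abs_Zterm.
by move=> w _; rewrite gee0_abs//; exact: s0.
Qed.

Lemma cvgn_Zterm_ae i j :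
  {ae Pr i, forall w, cvgn (series (Ztermc j (path_of (X i) w)))}.
Proof.
apply: filterS (integrable_ae measurableT (integrable_sumZ i j)) => w /(_ I).
rewrite ge0_fin_numE; last by apply: nneseries_ge0.
by move=> /cvgn_normed_Zterm /normed_cvg.
Qed.

(** Dominated by [sumZ]: trivially where [sumZ] is infinite, by absolute convergence elsewhere. *)
Lemma integrable_Z i j :
  (Pr i).-integrable setT (EFin \o (Zc j \o path_of (X i))).
Proof.
apply: le_integrable (integrable_sumZ i j) => //.
  apply/measurable_EFinP.
  apply: (measurableT_comp (f := Zc j : path_space i -> R)).
    by apply: measurable_Z => n l; exact: measurable_coord.
  exact: measurable_path_chain.
move=> w _ /=; rewrite gee0_abs; last by apply: nneseries_ge0.
move: (path_of _ _) => x; have [xoo|] := ltP (sumZ j x) +oo%E; last first.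
  by rewrite leye_eq => /eqP ->; rewrite leey.
have cx := cvgn_normed_Zterm xoo.
apply: le_trans (_ : ((limn [normed series (Ztermc j x)])%:E <= _)%E).
  by rewrite lee_fin; exact: lim_series_norm.
rewrite -[leRHS]fineK ?ge0_fin_numE//; last by apply: nneseries_ge0.
rewrite lee_fin; apply: limr_le => //; apply: nearW => n.
rewrite -lee_fin fineK ?sum_abs_Zterm_ge// ge0_fin_numE//.
by apply: nneseries_ge0.
Qed.

(** At a finite hitting time [t] the path is at [j], so [|alpha|] is the term of index [t] of
    [sumZ]. *)
Lemma integrable_alpha i j :
  (Pr i).-integrable setT (EFin \o (alphac j \o path_of (X i))).
Proof.
apply: le_integrable (integrable_sumZ i j) => //.
  apply/measurable_EFinP.
  apply: (measurableT_comp (f := alphac j : path_space i -> R)).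
    by apply: measurable_alpha => n l; exact: measurable_coord.
  exact: measurable_path_chain.
move=> w _ /=; rewrite gee0_abs; last by apply: nneseries_ge0.
move: (path_of _ _) => x; rewrite alphaE.
case hx : hitting_time => [t|]; last by rewrite normr0 nneseries_ge0.
move/hitting_time_SomeP : hx => [_ xt _].
apply: le_trans (sum_abs_Zterm_ge j x t.+1); rewrite lee_fin.
rewrite big_nat_recr//= {2}/Zterm xt eqxx mulr1 lerDr.
exact: sumr_ge0.
Qed.

Lemma integral_affine (e : measure_display) (T : measurableType e)
    (mu : probability T R) (c r : R) (Y : T -> R) :
  mu.-integrable setT (EFin \o Y) ->
  mu.-integrable setT (fun w => c%:E + r%:E * (Y w)%:E)%E /\
  (\int[mu]_w (c%:E + r%:E * (Y w)%:E) =
   (c + r * fine (\int[mu]_w (Y w)%:E))%:E)%E.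
Proof.
move=> iY; have ic : mu.-integrable setT (EFin \o cst c).
  exact: finite_measure_integrable_cst.
have irY : mu.-integrable setT (fun w => r%:E * (Y w)%:E)%E.
  exact: integrableZl.
split; first exact: integrableD.
rewrite integralD//; rewrite [X in (X + _)%E]integral_cst//.
rewrite [X in (_ * X)%E](@probability_setT _ _ _ mu) mule1 integralZl//.
by rewrite EFinD EFinM fineK//; exact: integrable_fin_num.
Qed.

Lemma measurable_Zc (i0 j : 'I_d) :
  measurable_fun setT (Zc j : path_space i0 -> R).
Proof. by apply: measurable_Z => n l; exact: measurable_coord. Qed.

Lemma measurable_alphac (i0 j : 'I_d) :
  measurable_fun setT (alphac j : path_space i0 -> R).
Proof. by apply: measurable_alpha => n l; exact: measurable_coord. Qed.

Definition expect_Z i j := fine (\int[Pr i]_w (Zc j (path_of (X i) w))%:E)%E.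

Definition expect_alpha i j :=
  fine (\int[Pr i]_w (alphac j (path_of (X i) w))%:E)%E.

Lemma expect_Z_first_step i j :
  expect_Z i j = (i == j)%:R + \sum_l A i l * expect_Z l j.
Proof.
have aff l := integral_affine (i == j)%:R (A i l / P i l) (integrable_Z l j).
rewrite /expect_Z (integral_first_step Ps X_chain (i0 := i)
  (f := fun x => (Zc j x)%:E)
  (g := fun l x => ((i == j)%:R%:E + (A i l / P i l)%:E * (Zc j x)%:E)%E)).
- under eq_bigr => l _ do rewrite (aff l).2 -EFinM mulrDr mulrA mulP_ratio.
  rewrite sumEFin /= big_split/= -mulr_suml Ps.2 mul1r.
  by [].
- by apply/measurable_EFinP; exact: measurable_Zc.
- move=> l; apply: emeasurable_funD => //; apply: measurable_funeM.
  by apply/measurable_EFinP; exact: measurable_Zc.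
- by move=> l; exact: (aff l).1.
- move=> l; apply: filterS (cvgn_Zterm_ae l j) => w cw Xl.
  by rewrite Z_cons// {1 2}/path_of Xl EFinD EFinM.
Qed.

Lemma expect_alpha_first_step i j :
  expect_alpha i j = A i j + \sum_(l | l != j) A i l * expect_alpha l j.
Proof.
(* The two cases of [alpha_cons] become one affine function: a constant for [l = j], a multiple of
   [alpha] otherwise. *)
pose c l := if l == j then A i l / P i l else 0.
pose r l := if l == j then 0 else A i l / P i l.
have aff l := integral_affine (c l) (r l) (integrable_alpha l j).
rewrite /expect_alpha (integral_first_step Ps X_chain (i0 := i)
  (f := fun x => (alphac j x)%:E)
  (g := fun l x => ((c l)%:E + (r l)%:E * (alphac j x)%:E)%E)).
- under eq_bigr => l _ do rewrite (aff l).2 -EFinM.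
  rewrite sumEFin /= (bigD1 j)//= /c /r eqxx mul0r addr0 mulP_ratio.
  by congr (_ + _); apply: eq_bigr => l /negbTE ->; rewrite add0r mulrA mulP_ratio.
- by apply/measurable_EFinP; exact: measurable_alphac.
- move=> l; apply: emeasurable_funD => //; apply: measurable_funeM.
  by apply/measurable_EFinP; exact: measurable_alphac.
- by move=> l; exact: (aff l).1.
- move=> l; apply: aeW => w Xl; rewrite alpha_cons {1 2 3}/path_of Xl /c /r.
  by case: eqP => _; rewrite ?mulr1 ?mul0e ?adde0// add0e EFinM.
Qed.

(** The first-step recursion exhibits a right inverse of [1 - A], which is the inverse for square
    matrices. *)
Lemma expect_Z_inverse : invmx (1%:M - A) = \matrix_(i, j) expect_Z i j.
Proof.
set M := \matrix_(i, j) _.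
have AM : (1%:M - A) *m M = 1%:M.
  rewrite mulmxBl mul1mx; apply/matrixP => i j; rewrite !mxE.
  rewrite expect_Z_first_step; under [X in _ - X]eq_bigr do rewrite mxE.
  by rewrite addrK.
by have [/mulKmx/(_ M) <- _] := mulmx1_unit AM; rewrite AM mulmx1.
Qed.

Lemma expect_Z_alpha i j :
  expect_Z i j = (i == j)%:R + expect_alpha i j * expect_Z j j.
Proof.
(* When the two recursions are subtracted, the contribution [A i j * expect_Z j j] of a first step
   to [j] occurs in both and cancels. *)
pose D l := expect_Z l j - (l == j)%:R - expect_alpha l j * expect_Z j j.
suff : D i = 0.
  by rewrite /D => /eqP; rewrite subr_eq0 => /eqP <-; rewrite addrC subrK.
have [q [C [q01 C0 AC]]] := mxabs_powers Ps P_supp rhoH.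
apply: (contraction_fixpoint_eq0 q01 AC) => {}i.
have -> : D i = \sum_(l | l != j) A i l * D l.
  rewrite /D expect_Z_first_step expect_alpha_first_step (bigD1 j)//=.
  rewrite [_%:R + _]addrC addrK mulrDl opprD addrACA subrr add0r.
  rewrite mulr_suml -sumrB; apply: eq_bigr => l /negbTE ->.
  by rewrite subr0 mulrBr mulrA.
apply: le_trans (ler_norm_sum _ _ _) _.
(* Restoring the nonnegative term of index [j] replaces the truncated matrix by [absA], whose powers
   decay. *)
rewrite [leRHS](bigD1 j)//= -[leLHS]add0r lerD ?mulr_ge0//.
  by rewrite mxE.
by apply: ler_sum => l _; rewrite normrM mxE.
Qed.

(** * The law of [Z] as that of a product of independent variables *)

Section Law.
Variables (j : 'I_d) (B : set R).
Hypothesis mB : measurable B.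

(** Subtracting [(i == j)] discards the visit at time 0, in accordance with hitting times being
    positive. The scale [c] is there to absorb the ratio of the first step. *)
Let shiftedZ i (c : R) : set (path_space j) :=
  [set x | B (c * (Zc j x - (i == j)%:R))].

Let law_shiftedZ i (c : R) : \bar R :=
  Pr i (path_of (X i) @^-1` shiftedZ i c).

Let law_Z (c : R) : \bar R :=
  Pr j (path_of (X j) @^-1` [set x | B (c * Zc j x)]).

(** By Fubini, the probability that [c] times the product of independent copies of [alpha] and of
    [Z] started at [j] lies in [B]. *)
Let law_product i (c : R) : \bar R :=
  (\int[Pr i]_w law_Z (c * alphac j (path_of (X i) w)))%E.

Let measurable_in (e : measure_display) (T : measurableType e) (f : T -> R) :
  measurable_fun setT f -> measurable [set x | B (f x)].
Proof. by move=> mf; rewrite -[X in measurable X]setTI; exact: mf. Qed.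

Let measurable_scale (e : measure_display) (T : measurableType e) (f : T -> R)
  (c : R) : measurable_fun setT f -> measurable_fun setT (fun x => c * f x).
Proof. by move=> mf; apply: (@measurable_funM _ _ R setT (cst c) f). Qed.

Lemma measurable_path_preimage i (E : set (path_space j)) :
  measurable E -> measurable (path_of (X i) @^-1` E : set (Omega i)).
Proof.
by move=> mE; rewrite -[X in measurable X]setTI; exact: measurable_path_chain.
Qed.

Lemma measurable_shiftedZ i c : measurable (shiftedZ i c).
Proof.
apply: (measurable_in
  (f := fun x : path_space j => c * (Zc j x - (i == j)%:R))).
apply: measurable_scale; apply: measurable_funB => //.
exact: measurable_Zc.
Qed.

Lemma measurable_scaledZ c :
  measurable ([set x | B (c * Zc j x)] : set (path_space j)).
Proof.
apply: (measurable_in (f := fun x : path_space j => c * Zc j x)).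
by apply: measurable_scale; exact: measurable_Zc.
Qed.

Let scaledZ : set (R * Omega j) :=
  [set p | B (p.1 * Zc j (path_of (X j) p.2))].

(** The value at [c] is the probability of the section at [c] of a measurable set in a product
    space. *)
Lemma measurable_law_Z : measurable_fun setT law_Z.
Proof.
have mS : measurable scaledZ.
  apply: (measurable_in
    (f := fun p : R * Omega j => p.1 * Zc j (path_of (X j) p.2))).
  apply: (@measurable_funM _ _ R setT fst
    (fun p => Zc j (path_of (X j) p.2))) => //.
  have mp : measurable_fun setT (path_of (X j) : Omega j -> path_space j).
    exact: measurable_path_chain.
  have mZ : measurable_fun setT (fun w : Omega j => Zc j (path_of (X j) w)).
    apply: (measurableT_comp (f := Zc j : path_space j -> R)) => //.
    exact: measurable_Zc.
  exact: (measurableT_comp mZ measurable_snd).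
have -> : law_Z = (Pr j \o xsection scaledZ).
  apply/funext => c; congr (Pr j _); apply/seteqP.
  by split=> w /=; rewrite /xsection/= inE.
exact: measurable_fun_xsection.
Qed.

Let prob_int i (E : set (path_space j)) : measurable E ->
  (\int[Pr i]_w (\1_E (path_of (X i) w))%:E = Pr i (path_of (X i) @^-1` E))%E.
Proof.
move=> mE.
have := integral_indic (Pr i) measurableT (measurable_path_preimage i mE).
by rewrite setIT.
Qed.

(** [Z_cons] leaves the unshifted [Z] started at [l]. It has the law [law_Z] if [l = j]; otherwise
    the shift at [l] is 0 and [law_shiftedZ] reappears. *)
Lemma law_shiftedZ_first_step i c :
  (law_shiftedZ i c = \sum_l (P i l)%:E *
    if l == j then law_Z (c * (A i l / P i l))
    else law_shiftedZ l (c * (A i l / P i l)))%E.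
Proof.
pose S l : set (path_space j) := [set x | B (c * (A i l / P i l) * Zc j x)].
have mS l : measurable (S l) by exact: measurable_scaledZ.
rewrite /law_shiftedZ -prob_int; last exact: measurable_shiftedZ.
rewrite (ge0_integral_first_step Ps X_chain (i0 := j)
  (f := fun x => (\1_(shiftedZ i c) x)%:E) (g := fun l x => (\1_(S l) x)%:E)).
- apply: eq_bigr => l _; rewrite prob_int//; congr (_ * _)%E.
  case: eqP => [->//|/eqP/negbTE lj].
  congr (Pr l _); apply/seteqP.
  by split=> w /=; rewrite /S /shiftedZ/= lj subr0.
- by apply/measurable_EFinP; apply: measurable_indic; exact: measurable_shiftedZ.
- by move=> x; rewrite lee_fin.
- by move=> l; apply/measurable_EFinP; exact: measurable_indic.
- by move=> l x; rewrite lee_fin.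
- move=> l; apply: filterS (cvgn_Zterm_ae l j) => w cw Xl.
  rewrite !indicE; congr (nat_of_bool _)%:R%:E.
  rewrite -[LHS]/(`[< B (c * (Zc j (cons_path i (path_of (X l) w)) -
                             (i == j)%:R)) >]).
  rewrite -[RHS]/(`[< B (c * (A i l / P i l) * Zc j (path_of (X l) w)) >]).
  have -> : c * (Zc j (cons_path i (path_of (X l) w)) - (i == j)%:R) =
      c * (A i l / P i l) * Zc j (path_of (X l) w).
    by rewrite Z_cons// {1 2}/path_of Xl addrAC subrr add0r mulrA.
  by [].
Qed.

(** If the first step reaches [j], [alpha] is the ratio alone and the integrand is constant;
    otherwise the ratio moves into the scale. *)
Lemma law_product_first_step i c :
  (law_product i c = \sum_l (P i l)%:E *
    if l == j then law_Z (c * (A i l / P i l))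
    else law_product l (c * (A i l / P i l)))%E.
Proof.
have ma : measurable_fun setT (alphac j : path_space j -> R).
  exact: measurable_alphac.
have mca c' : measurable_fun setT (fun x : path_space j => law_Z (c' * alphac j x)).
  apply: (measurableT_comp measurable_law_Z).
  by apply: measurable_scale.
rewrite /law_product (ge0_integral_first_step Ps X_chain (i0 := j)
  (f := fun x => law_Z (c * alphac j x))
  (g := fun l x => if l == j then law_Z (c * (A i l / P i l))
    else law_Z (c * (A i l / P i l) * alphac j x))).
- apply: eq_bigr => l _; congr (_ * _)%E; case: eqP => // _.
  rewrite integral_cst// [X in (_ * X)%E](@probability_setT _ _ _ (Pr l)).
  by rewrite mule1.
- exact: mca.
- by move=> x; exact: measure_ge0.
- by move=> l; case: eqP.
- by move=> l x; case: eqP => _; exact: measure_ge0.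
- move=> l; apply: aeW => w Xl; rewrite alpha_cons {1 2 3}/path_of Xl mulrA.
  by case: eqP => _; rewrite ?mulr1.
Qed.

Lemma law_shiftedZE i c : law_shiftedZ i c = law_product i c.
Proof.
have law_Z01 c' : (0 <= law_Z c' <= 1)%E.
  rewrite measure_ge0/=; apply: probability_le1.
  by apply: measurable_path_preimage; exact: measurable_scaledZ.
have sh01 l c' : (0 <= law_shiftedZ l c' <= 1)%E.
  rewrite measure_ge0/=; apply: probability_le1.
  by apply: measurable_path_preimage; exact: measurable_shiftedZ.
have law_Z_ge0 c' : (0 <= law_Z c')%E by case/andP: (law_Z01 c').
have law_Z_le1 c' : (law_Z c' <= 1)%E by case/andP: (law_Z01 c').
have pr01 l c' : (0 <= law_product l c' <= 1)%E.
  apply/andP; split; first by apply: integral_ge0 => w _; exact: law_Z_ge0.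
  apply: (@le_trans _ _ (\int[Pr l]_w (cst 1%E w))%E); last first.
    rewrite integral_cst// [X in (_ * X)%E](@probability_setT _ _ _ (Pr l)).
    by rewrite mule1.
  apply: ge0_le_integral => //.
  apply: (measurableT_comp measurable_law_Z); apply: measurable_scale.
  apply: (measurableT_comp (f := alphac j : path_space j -> R)).
    exact: measurable_alphac.
  exact: measurable_path_chain.
have fin x : (0 <= x <= 1)%E -> x = (fine x)%:E :> \bar R.
  move=> /andP[x0 x1]; rewrite fineK// ge0_fin_numE//.
  by rewrite (le_lt_trans x1)// ltry.
have fin1 (x : \bar R) : (0 <= x <= 1)%E -> 0 <= fine x <= 1.
  by move=> h; rewrite -!lee_fin -(fin _ h).
pose delta l c' := `|fine (law_shiftedZ l c') - fine (law_product l c')|.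
have delta1 l c' : delta l c' <= 1.
  have := fin1 _ (sh01 l c'); have := fin1 _ (pr01 l c').
  rewrite /delta ler_norml => /andP[? ?] /andP[? ?]; apply/andP; split; lra.
(* The recursions change the scale; the supremum over all scales depends on the state only. It is
   finite, as probabilities differ by at most 1. *)
pose u l := sup (range (delta l)).
have u_ub l c' : delta l c' <= u l.
  apply: sup_ubound; last by exists c'.
  by exists 1 => _ [c'' _ <-].
suff uP l : u l <= \sum_(k | k != j) P l k * u k.
  have := killed_subharmonic_le0 Ps P_irr uP i.
  move/(le_trans (u_ub i c)); rewrite normr_le0 subr_eq0 => /eqP h.
  by rewrite (fin _ (sh01 i c)) h -fin.
apply: ge_sup; first by exists (delta l 0), 0.
move=> _ [c' _ <-].
(* The two families agree at [k = j], so that this term drops out of the difference and the killed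
   chain remains. *)
pose t k := if k == j then fine (law_Z (c' * (A l k / P l k)))
  else fine (law_shiftedZ k (c' * (A l k / P l k))).
pose t' k := if k == j then fine (law_Z (c' * (A l k / P l k)))
  else fine (law_product k (c' * (A l k / P l k))).
have shE : fine (law_shiftedZ l c') = \sum_k P l k * t k.
  rewrite law_shiftedZ_first_step (eq_bigr (fun k => (P l k * t k)%:E)).
    by rewrite sumEFin.
  by move=> k _; rewrite EFinM /t; case: eqP => _; rewrite -fin.
have prE : fine (law_product l c') = \sum_k P l k * t' k.
  rewrite law_product_first_step (eq_bigr (fun k => (P l k * t' k)%:E)).
    by rewrite sumEFin.
  by move=> k _; rewrite EFinM /t'; case: eqP => _; rewrite -fin.
rewrite /delta shE prE -sumrB (bigD1 j)//= /t /t' eqxx subrr add0r.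
apply: le_trans (ler_norm_sum _ _ _) _; apply: ler_sum => k /negbTE ->.
rewrite -mulrBr normrM (ger0_norm (Ps.1 l k)) ler_wpM2l//.
  exact: Ps.1.
exact: u_ub.
Qed.

(** The case of scale 1, where the shift is 0 because [i != j]; the product measure is by definition
    an integral of measures of sections. *)
Lemma law_Z_product i : i != j ->
  Pr i ([set w | B (Zc j (path_of (X i) w))]) =
  (Pr i \x Pr j)%E [set p | B (alphac j (path_of (X i) p.1) *
                             Zc j (path_of (X j) p.2))].
Proof.
move=> /negbTE ij; have := law_shiftedZE i 1.
rewrite /law_shiftedZ /law_product /product_measure1 => h.
transitivity (Pr i (path_of (X i) @^-1` shiftedZ i 1)).
  by congr (Pr i _); apply/seteqP; split=> w; rewrite /shiftedZ /= ij subr0 mul1r.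
rewrite h; apply: eq_integral => w _ /=; rewrite mul1r; congr (Pr j _).
by apply/seteqP; split=> w' /=; rewrite /xsection/= inE.
Qed.

End Law.

End Moments.

(** * Well-definedness, the formulas for the entries of [C], and the product law *)

Theorem mainTheorem5 (R : realType) (d : nat) (A C P : 'M[R]_d)
    (rhoA : spectral_radius A < 1)
    (C_def : C = invmx (1%:M - A))
    (P_stoch : stochastic P)
    (P_supp : forall i j, 0 < P i j <-> A i j != 0)
    (P_irr : irreducible_chain P)
    (P_aper : aperiodic_chain P)
    (rhoH : spectral_radius (Hhat A P) < 1)
    (disp : 'I_d -> measure_display)
    (Omega : forall i, measurableType (disp i))
    (Pr : forall i, probability (Omega i) R)
    (X : forall i, nat -> Omega i -> 'I_d)
    (X_chain : forall i, markov_chain (Pr i) P i (X i)) :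
  [/\ (* the random variables are almost surely well defined, and have
         expectations *)
      forall i j,
        [/\ {ae Pr i, forall w, hitting_time (X i) j w <> None},
            {ae Pr i, forall w, cvgn (series (Zterm A P (X i) j w))},
            (Pr i).-integrable setT (EFin \o alpha A P (X i) j) &
            (Pr i).-integrable setT (EFin \o Z A P (X i) j)],
      (* (1) *)
      forall i,
        ('E_(Pr i)[Z A P (X i) i] =
           (1 - 'E_(Pr i)[alpha A P (X i) i])^-1)%E /\
        ((1 - 'E_(Pr i)[alpha A P (X i) i])^-1 = (C i i)%:E)%E &
      (* (2) *)
      forall i j, i != j ->
        (exists (disp' : measure_display) (T : measurableType disp')
           (Q : probability T R) (U V : {RV Q >-> R}),
           [/\ independent_RV Q U V,
               same_distribution Q (Pr i) U (alpha A P (X i) j),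
               same_distribution Q (Pr j) V (Z A P (X j) j) &
               same_distribution (Pr i) Q (Z A P (X i) j) (U \* V)])
        /\ ((C i j)%:E = 'E_(Pr i)[alpha A P (X i) j] * (C j j)%:E)%E].
Proof.
have mX := measurable_chain X_chain.
have alphaP i j : alpha A P (X i) j = alpha A P (@eval_at d) j \o path_of (X i).
  by [].
have ZP i j : Z A P (X i) j = Z A P (@eval_at d) j \o path_of (X i).
  by apply/funext => w; rewrite Z_path.
have ZT i j : Zterm A P (X i) j = Zterm A P (@eval_at d) j \o path_of (X i).
  by apply/funext => w; rewrite Zterm_path.
have ia i j : (Pr i).-integrable setT (EFin \o alpha A P (X i) j).
  exact: (integrable_alpha P_stoch P_supp rhoH X_chain).
have iZ i j : (Pr i).-integrable setT (EFin \o Z A P (X i) j).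
  by rewrite ZP; exact: (integrable_Z P_stoch P_supp rhoH X_chain).
pose EZ := expect_Z A P Pr X.
pose Ea := expect_alpha A P Pr X.
have EaE i j : ('E_(Pr i)[alpha A P (X i) j] = (Ea i j)%:E)%E.
  by rewrite unlock /Ea /expect_alpha fineK//; exact: integrable_fin_num (ia i j).
have EZE i j : ('E_(Pr i)[Z A P (X i) j] = (EZ i j)%:E)%E.
  rewrite unlock ZP /EZ /expect_Z fineK//.
  by apply: integrable_fin_num => //; have := iZ i j; rewrite ZP.
have CE i j : C i j = EZ i j.
  by rewrite C_def (expect_Z_inverse P_stoch P_supp rhoH X_chain) mxE.
have EZa i j : EZ i j = (i == j)%:R + Ea i j * EZ j j.
  exact: (expect_Z_alpha P_stoch P_supp rhoH X_chain).
split.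
- move=> i j; split=> //.
    exact: (hitting_time_ae P_stoch P_irr X_chain).
  by rewrite ZT; exact: (cvgn_Zterm_ae P_stoch P_supp rhoH X_chain).
- move=> i; rewrite EaE EZE CE -EFinB.
  (* This is [EZa] on the diagonal. It also shows that [1 - Ea i i] is nonzero, so that its extended
     inverse is the real one. *)
  have h : (1 - Ea i i) * EZ i i = 1.
    by rewrite mulrBl mul1r {1}EZa eqxx addrK.
  have n0 : 1 - Ea i i != 0.
    by apply: contra_eq_neq h => ->; rewrite mul0r eq_sym oner_eq0.
  rewrite inver (negbTE n0); split=> //; congr (_%:E).
    by apply: (mulfI n0); rewrite h divff.
  by apply: (mulfI n0); rewrite h divff.
- move=> i j ij; split; last first.
    by rewrite EaE !CE EZa (negbTE ij) add0r EFinM.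
  (* The independent copies live on the product space: [alpha] of the first coordinate and [Z] of
     the second. *)
  pose Q : probability (Omega i * Omega j)%type R := (Pr i \x Pr j)%E.
  have ma : measurable_fun setT (alpha A P (X i) j) by exact: measurable_alpha.
  have mZ k l : measurable_fun setT (Z A P (X k) l) by exact: measurable_Z.
  have mU : measurable_fun setT (alpha A P (X i) j \o fst : Omega i * Omega j -> R).
    exact: measurableT_comp.
  have mV : measurable_fun setT (Z A P (X j) j \o snd : Omega i * Omega j -> R).
    exact: measurableT_comp.
  have pre (e : measure_display) (T : measurableType e) (f : T -> R) B :
      measurable_fun setT f -> measurable B -> measurable (f @^-1` B).
    by move=> mf mB; rewrite -[X in measurable X]setTI; exact: mf.
  pose U : {RV Q >-> R} :=
    HB.pack (alpha A P (X i) j \o fst : Omega i * Omega j -> R)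
    (isMeasurableFun.Build _ _ _ _ _ mU).
  pose V : {RV Q >-> R} :=
    HB.pack (Z A P (X j) j \o snd : Omega i * Omega j -> R)
    (isMeasurableFun.Build _ _ _ _ _ mV).
  have QU B : measurable B -> Q (U @^-1` B) = Pr i (alpha A P (X i) j @^-1` B).
    move=> mB; rewrite (_ : U @^-1` B = (alpha A P (X i) j @^-1` B) `*` setT).
      rewrite [LHS]product_measure1E//; last exact: pre.
      by rewrite [X in (_ * X)%E](@probability_setT _ _ _ (Pr j)) mule1.
    by apply/seteqP; split=> // w [].
  have QV B : measurable B -> Q (V @^-1` B) = Pr j (Z A P (X j) j @^-1` B).
    move=> mB; rewrite (_ : V @^-1` B = setT `*` (Z A P (X j) j @^-1` B)).
      rewrite [LHS]product_measure1E//; last exact: pre.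
      by rewrite [X in (X * _)%E](@probability_setT _ _ _ (Pr i)) mul1e.
    by apply/seteqP; split=> // w [].
  exists _, _, Q, U, V; split.
  + move=> B1 B2 mB1 mB2; rewrite QU// QV//.
    rewrite -product_measure1E; [|exact: pre|exact: pre].
    by congr (Q _).
  + by split=> // B mB; rewrite QU.
  + by split=> // B mB; rewrite QV.
  + split=> // B mB.
    rewrite ZP.
    have := law_Z_product P_stoch P_supp P_irr rhoH X_chain mB ij => h.
    rewrite [LHS]h; congr (Q _); apply/seteqP.
    by split=> w /=; rewrite ZP.
Qed.
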